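(* Let $m\ge 2$ be an even integer, $n=m^2$, let $y_{k\ell}\in\mathbb{R}$ ($k,\ell=1,\dots,m$) be responses at the tensor product design points $(k/m,\ell/m)$, and let $\lambda>0$. Let $(\hat\theta_1,\hat\theta_2,\hat\theta_{12},\hat f)$ minimize, over $\theta_1,\theta_2,\theta_{12}\ge0$ and $f=b+f_1+f_2+f_{12}\in\mathcal{F}_m$, the COSSO objective $$\frac1n\sum_{k=1}^m\sum_{\ell=1}^m\{y_{k\ell}-f(k/m,\ell/m)\}^2+\theta_1^{-1}\int_0^1\{f_1''(s)\}^2ds+\theta_2^{-1}\int_0^1\{f_2''(t)\}^2dt+\theta_{12}^{-1}\int_0^1\!\!\int_0^1\Big\{\frac{\partial^4f_{12}(s,t)}{\partial s^2\partial t^2}\Big\}^2ds\,dt+\lambda(\theta_1+\theta_2+\theta_{12}).$$ Put $z_{\mu\nu}=\frac1n\sum_{k,\ell=1}^m y_{k\ell}\,\gamma_\mu(k/m)\gamma_\nu(\ell/m)$ and $$U_1=\sum_{\mu=2}^m q_{\mu1}^{-1}z_{\mu1}^2,\qquad U_2=\sum_{\nu=2}^m q_{1\nu}^{-1}z_{1\nu}^2,\qquad U_{12}=\sum_{\mu=2}^m\sum_{\nu=2}^m q_{\mu\nu}^{-1}z_{\mu\nu}^2 .$$ Then for each $\alpha\in\{1,2,12\}$: if $U_\alpha\le\lambda$ then $\hat\theta_\alpha=0$ (and hence $\hat f_\alpha=0$), while if $U_\alpha>\lambda$ then $\hat\theta_\alpha>0$.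
   Context: Basis functions on $[0,1]$: $\gamma_1(t)=1$; $\gamma_{2\nu}(t)=\sqrt2\cos(2\pi\nu t)$ and $\gamma_{2\nu+1}(t)=\sqrt2\sin(2\pi\nu t)$ for $\nu=1,\dots,m/2-1$; $\gamma_m(t)=\cos(\pi mt)$. $\bar T_m=\mathrm{span}\{\gamma_2,\dots,\gamma_m\}$, $T_m=\{1\}\oplus\bar T_m$, and $$\mathcal{F}_m=T_m\otimes T_m=\{1\}\oplus\bar T_m^1\oplus\bar T_m^2\oplus(\bar T_m^1\otimes\bar T_m^2),$$ i.e. all functions $f(s,t)=\sum_{\mu,\nu=1}^m a_{\mu\nu}\gamma_\mu(s)\gamma_\nu(t)$. The components are $b=a_{11}$, $f_1(s)=\sum_{\mu\ge2}a_{\mu1}\gamma_\mu(s)$, $f_2(t)=\sum_{\nu\ge2}a_{1\nu}\gamma_\nu(t)$, $f_{12}(s,t)=\sum_{\mu,\nu\ge2}a_{\mu\nu}\gamma_\mu(s)\gamma_\nu(t)$. The constants $q_{\mu\nu}>0$ (for $(\mu,\nu)\ne(1,1)$) are the coefficients that make the penalty integrals diagonal: $\int(f_1'')^2=\sum_{\mu\ge2}q_{\mu1}a_{\mu1}^2$, $\int(f_2'')^2=\sum_{\nu\ge2}q_{1\nu}a_{1\nu}^2$, $\iint(\partial_s^2\partial_t^2f_{12})^2=\sum_{\mu,\nu\ge2}q_{\mu\nu}a_{\mu\nu}^2$. That is, with $\kappa_\mu=\int_0^1\{\gamma_\mu''(t)\}^2dt$, $q_{\mu1}=\kappa_\mu$,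 $q_{1\nu}=\kappa_\nu$, $q_{\mu\nu}=\kappa_\mu\kappa_\nu$ for $\mu,\nu\ge2$. Convention: if $\theta_\alpha=0$ then $f_\alpha$ must be $0$ and the corresponding penalty term is $0$ ($0/0=0$). *)

(* Defs.v *)
From Stdlib Require Import Reals Arith.
From Coquelicot Require Import Coquelicot.
Open Scope R_scope.

(* Meaningful for m even, m >= 2 and 1 <= mu <= m; for 1 < mu < m the
   frequency is nu = mu / 2 both for mu = 2 nu and for mu = 2 nu + 1.
   Elements of the spans below are functions on all of R rather than [0,1]:
   they are trigonometric polynomials, determined by their restriction, and
   this gives derivatives at the endpoints their usual meaning. *)
Definition gamma (m mu : nat) (t : R) : R :=
  if Nat.eqb mu 1 then 1
  else if Nat.eqb mu m then cos (PI * INR m * t)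
  else if Nat.even mu then sqrt 2 * cos (2 * PI * INR (Nat.div2 mu) * t)
  else sqrt 2 * sin (2 * PI * INR (Nat.div2 mu) * t).

(* f lies in F_m, with components b, f1, f2, f12. *)
Definition anova (m : nat) (f : R -> R -> R)
    (b : R) (f1 f2 : R -> R) (f12 : R -> R -> R) : Prop :=
  exists a : nat -> nat -> R,
    (forall s t, f s t =
       sum_n_m (fun mu => sum_n_m (fun nu =>
         a mu nu * gamma m mu s * gamma m nu t) 1 m) 1 m) /\
    b = a 1%nat 1%nat /\
    (forall s, f1 s = sum_n_m (fun mu => a mu 1%nat * gamma m mu s) 2 m) /\
    (forall t, f2 t = sum_n_m (fun nu => a 1%nat nu * gamma m nu t) 2 m) /\
    (forall s t, f12 s t =
       sum_n_m (fun mu => sum_n_m (fun nu =>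
         a mu nu * gamma m mu s * gamma m nu t) 2 m) 2 m).

Definition penalty1 (g : R -> R) : R :=
  RInt (fun t => (Derive_n g 2 t) ^ 2) 0 1.

Definition penalty2 (h : R -> R -> R) : R :=
  RInt (fun s => RInt (fun t =>
    (Derive_n (fun s' => Derive_n (fun t' => h s' t') 2 t) 2 s) ^ 2) 0 1) 0 1.

Definition kappa (m mu : nat) : R := penalty1 (gamma m mu).

(* Used only for (mu, nu) <> (1, 1). *)
Definition q (m mu nu : nat) : R :=
  if Nat.eqb nu 1 then kappa m mu
  else if Nat.eqb mu 1 then kappa m nu
  else kappa m mu * kappa m nu.

Record cosso_arg : Type := CossoArg {
  th1 : R; th2 : R; th12 : R;
  fit : R -> R -> R;
  comp0 : R; comp1 : R -> R; comp2 : R -> R; comp12 : R -> R -> R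
}.

Definition feasible (m : nat) (c : cosso_arg) : Prop :=
  anova m (fit c) (comp0 c) (comp1 c) (comp2 c) (comp12 c) /\
  0 <= th1 c /\ 0 <= th2 c /\ 0 <= th12 c /\
  (th1 c = 0 -> forall s, comp1 c s = 0) /\
  (th2 c = 0 -> forall t, comp2 c t = 0) /\
  (th12 c = 0 -> forall s t, comp12 c s t = 0).

(* At a feasible argument a vanishing theta multiplies a vanishing penalty, so
   that the term / theta * penalty is 0, i.e. 0/0 = 0. *)
Definition cosso_obj (m : nat) (y : nat -> nat -> R) (lambda : R)
    (c : cosso_arg) : R :=
  / INR (m ^ 2) *
    sum_n_m (fun k => sum_n_m (fun l =>
      (y k l - fit c (INR k / INR m) (INR l / INR m)) ^ 2) 1 m) 1 m
  + / th1 c * penalty1 (comp1 c)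
  + / th2 c * penalty1 (comp2 c)
  + / th12 c * penalty2 (comp12 c)
  + lambda * (th1 c + th2 c + th12 c).

Definition is_cosso_minimizer (m : nat) (y : nat -> nat -> R) (lambda : R)
    (c : cosso_arg) : Prop :=
  feasible m c /\
  forall c', feasible m c' -> cosso_obj m y lambda c <= cosso_obj m y lambda c'.

Definition z (m : nat) (y : nat -> nat -> R) (mu nu : nat) : R :=
  / INR (m ^ 2) *
    sum_n_m (fun k => sum_n_m (fun l =>
      y k l * gamma m mu (INR k / INR m) * gamma m nu (INR l / INR m)) 1 m) 1 m.

Definition U1 (m : nat) (y : nat -> nat -> R) : R :=
  sum_n_m (fun mu => / q m mu 1 * (z m y mu 1) ^ 2) 2 m.

Definition U2 (m : nat) (y : nat -> nat -> R) : R :=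
  sum_n_m (fun nu => / q m 1 nu * (z m y 1 nu) ^ 2) 2 m.

Definition U12 (m : nat) (y : nat -> nat -> R) : R :=
  sum_n_m (fun mu => sum_n_m (fun nu =>
    / q m mu nu * (z m y mu nu) ^ 2) 2 m) 2 m.

(* Main.v *)
Require Import Defs.
From Stdlib Require Import Reals Arith Lia Lra.
From Coquelicot Require Import Coquelicot.
Open Scope R_scope.

(** In the coefficients a mu nu the minimization splits into separate problems,
    one for each component.

    The products of basis functions with different indices are combinations of
    waves whose integer frequencies lie strictly between 0 and m.  Both the
    average over the design points and the integral over [0, 1] annihilate such
    waves (wave_mean_design, wave_mean_RInt), so both turn the square of a
    combination of basis functions into a weighted sum of squared coefficients
    (parseval, parseval2).  Over the design all weights are 1.  Since the second
    derivative of a basis function is a multiple of it, the penalties become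
    sums of q * a ^ 2.  Up to a constant the objective is therefore the sum of
    (a 1 1 - z 1 1) ^ 2 and, for each component,

      sum of (a ^ 2 - 2 a z) + (1 / theta) * sum of q a ^ 2 + lambda * theta

    (cosso_obj_coefficients), and a minimizer minimizes each of these blocks
    (minimizer_blocks).

    In one block, the best coefficients for a given theta > 0 are
    a = theta z / (theta + q), with the value
    theta * (lambda - sum of z ^ 2 / (theta + q)).  The sum increases strictly to
    U = sum of z ^ 2 / q as theta decreases to 0, unless all z vanish, in which
    case U = 0 < lambda.  Hence
    the block is positive for every theta > 0 if U <= lambda (block_pos), and it
    is negative for small theta > 0 if U > lambda (block_neg).  As theta = 0
    gives the value 0, this decides whether the minimizing theta vanishes
    (block_threshold). *)

(** * Finite sums *)

(** The one induction behind termwise equality, comparison, scaling and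
    vanishing of sums: a relation that holds for the pair (0, 0) and is
    stable under addition passes from the terms to the sums. *)
Lemma sum_n_m_rel (P : R -> R -> Prop) (f g : nat -> R) (p r : nat) :
  P 0 0 ->
  (forall u v u' v', P u v -> P u' v' -> P (u + u') (v + v')) ->
  (forall k, (p <= k <= r)%nat -> P (f k) (g k)) ->
  P (sum_n_m f p r) (sum_n_m g p r).
Proof.
  intros H0 Hp. induction r as [|r IH]; intros H.
  - destruct p as [|p].
    + rewrite !sum_n_n. apply H; lia.
    + rewrite !sum_n_m_zero by lia. exact H0.
  - destruct (le_lt_dec p (S r)) as [h|h].
    + rewrite !sum_n_Sm by lia. apply Hp; [apply IH; intros; apply H; lia | apply H; lia].
    + rewrite !sum_n_m_zero by lia. exact H0.
Qed.

Lemma sum_n_m_eq (f g : nat -> R) (p r : nat) :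
  (forall k, (p <= k <= r)%nat -> f k = g k) -> sum_n_m f p r = sum_n_m g p r.
Proof.
  apply (sum_n_m_rel eq); [reflexivity | intros; congruence].
Qed.

Lemma sum_n_m_le_loc (f g : nat -> R) (p r : nat) :
  (forall k, (p <= k <= r)%nat -> f k <= g k) -> sum_n_m f p r <= sum_n_m g p r.
Proof.
  apply (sum_n_m_rel Rle); [lra | intros; lra].
Qed.

Lemma sum_n_m_scal (c : R) (f : nat -> R) (p r : nat) :
  sum_n_m (fun k => c * f k) p r = c * sum_n_m f p r.
Proof.
  apply (sum_n_m_rel (fun u v => u = c * v)); intros; subst; lra.
Qed.

Lemma sum_n_m_add (f g : nat -> R) (p r : nat) :
  sum_n_m (fun k => f k + g k) p r = sum_n_m f p r + sum_n_m g p r.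
Proof. apply (sum_n_m_plus f g). Qed.

Lemma sum_n_m_null (f : nat -> R) (p r : nat) :
  (forall k, (p <= k <= r)%nat -> f k = 0) -> sum_n_m f p r = 0.
Proof.
  intros H. apply (sum_n_m_rel (fun u _ => u = 0) f f); intros; auto; lra.
Qed.

Lemma sum_n_m_nonneg (f : nat -> R) (p r : nat) :
  (forall k, (p <= k <= r)%nat -> 0 <= f k) -> 0 <= sum_n_m f p r.
Proof.
  intros H. apply (sum_n_m_rel (fun u _ => 0 <= u) f f); intros; auto; lra.
Qed.

Lemma sum_n_m_last (f : nat -> R) (p r : nat) : (p <= S r)%nat ->
  sum_n_m f p (S r) = sum_n_m f p r + f (S r).
Proof. exact (sum_n_Sm f p r). Qed.

Lemma sum_n_m_first (f : nat -> R) (p r : nat) : (p <= r)%nat ->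
  sum_n_m f p r = f p + sum_n_m f (S p) r.
Proof. exact (sum_Sn_m f p r). Qed.

Lemma sum_n_m_split_at (f : nat -> R) (p r i : nat) : (p <= i <= r)%nat ->
  sum_n_m f p r =
  f i + sum_n_m (fun k => if Nat.eqb k i then 0 else f k) p r.
Proof.
  induction r as [|r IH]; intros H.
  - replace p with 0%nat by lia. replace i with 0%nat by lia.
    rewrite !sum_n_n. simpl. lra.
  - rewrite !sum_n_m_last by lia.
    destruct (Nat.eqb_spec (S r) i) as [<-|n].
    + rewrite (sum_n_m_eq (fun k => if (k =? S r)%nat then 0 else f k) f); [lra|].
      intros k hk. destruct (Nat.eqb_spec k (S r)); [lia|reflexivity].
    + rewrite IH by lia. lra.
Qed.

Lemma sum_n_m_single (f : nat -> R) (p r i : nat) : (p <= i <= r)%nat ->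
  (forall k, (p <= k <= r)%nat -> k <> i -> f k = 0) -> sum_n_m f p r = f i.
Proof.
  intros hi H. rewrite (sum_n_m_split_at f p r i hi), sum_n_m_null; [lra|].
  intros k hk. destruct (Nat.eqb_spec k i); auto.
Qed.

Lemma sum_n_m_ge_term (f : nat -> R) (p r i : nat) : (p <= i <= r)%nat ->
  (forall k, (p <= k <= r)%nat -> 0 <= f k) -> f i <= sum_n_m f p r.
Proof.
  intros hi H. rewrite (sum_n_m_split_at f p r i hi).
  assert (0 <= sum_n_m (fun k => if (k =? i)%nat then 0 else f k) p r); [|lra].
  apply sum_n_m_nonneg. intros k hk. destruct (Nat.eqb_spec k i); auto; lra.
Qed.

Lemma sum_n_m_switch (F : nat -> nat -> R) (p r p' r' : nat) :
  sum_n_m (fun i => sum_n_m (fun j => F i j) p' r') p r =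
  sum_n_m (fun j => sum_n_m (fun i => F i j) p r) p' r'.
Proof.
  induction r as [|r IH].
  - destruct p as [|p].
    + rewrite sum_n_n. apply sum_n_m_eq. intros. now rewrite sum_n_n.
    + rewrite sum_n_m_zero by lia. symmetry. apply sum_n_m_null.
      intros. now rewrite sum_n_m_zero by lia.
  - destruct (le_lt_dec p (S r)) as [h|h].
    + rewrite sum_n_Sm by lia. rewrite IH. unfold plus; simpl.
      rewrite <- sum_n_m_add. apply sum_n_m_eq. intros.
      now rewrite sum_n_Sm by lia.
    + rewrite sum_n_m_zero by lia. symmetry. apply sum_n_m_null.
      intros. now rewrite sum_n_m_zero by lia.
Qed.

(** The components of the decomposition correspond to rectangles of index
    pairs: [2, m] x [1, 1] and [1, 1] x [2, m] for the two main effects,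
    [2, m] x [2, m] for the interaction.  Treating the main effects as
    degenerate rectangles lets one argument serve all three. *)
Definition dsum (p r p' r' : nat) (F : nat -> nat -> R) : R :=
  sum_n_m (fun i => sum_n_m (fun j => F i j) p' r') p r.

Lemma dsum_eq p r p' r' F G :
  (forall i j, (p <= i <= r)%nat -> (p' <= j <= r')%nat -> F i j = G i j) ->
  dsum p r p' r' F = dsum p r p' r' G.
Proof. intros H. apply sum_n_m_eq; intros. apply sum_n_m_eq; auto. Qed.

Lemma dsum_le p r p' r' F G :
  (forall i j, (p <= i <= r)%nat -> (p' <= j <= r')%nat -> F i j <= G i j) ->
  dsum p r p' r' F <= dsum p r p' r' G.
Proof. intros H. apply sum_n_m_le_loc; intros. apply sum_n_m_le_loc; auto. Qed.

Lemma dsum_scal p r p' r' c F :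
  dsum p r p' r' (fun i j => c * F i j) = c * dsum p r p' r' F.
Proof.
  unfold dsum. rewrite <- sum_n_m_scal. apply sum_n_m_eq; intros.
  apply sum_n_m_scal.
Qed.

Lemma dsum_add p r p' r' F G :
  dsum p r p' r' (fun i j => F i j + G i j) = dsum p r p' r' F + dsum p r p' r' G.
Proof.
  unfold dsum. rewrite <- sum_n_m_add. apply sum_n_m_eq; intros.
  apply sum_n_m_add.
Qed.

Lemma dsum_null p r p' r' F :
  (forall i j, (p <= i <= r)%nat -> (p' <= j <= r')%nat -> F i j = 0) ->
  dsum p r p' r' F = 0.
Proof. intros H. apply sum_n_m_null; intros. apply sum_n_m_null; auto. Qed.

Lemma dsum_nonneg p r p' r' F :
  (forall i j, (p <= i <= r)%nat -> (p' <= j <= r')%nat -> 0 <= F i j) ->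
  0 <= dsum p r p' r' F.
Proof. intros H. apply sum_n_m_nonneg; intros. apply sum_n_m_nonneg; auto. Qed.

Lemma dsum_ge_term p r p' r' F i j :
  (p <= i <= r)%nat -> (p' <= j <= r')%nat ->
  (forall i j, (p <= i <= r)%nat -> (p' <= j <= r')%nat -> 0 <= F i j) ->
  F i j <= dsum p r p' r' F.
Proof.
  intros hi hj H.
  apply Rle_trans with (sum_n_m (fun j => F i j) p' r').
  - apply (sum_n_m_ge_term (fun j => F i j)); auto.
  - apply (sum_n_m_ge_term (fun i => sum_n_m (fun j => F i j) p' r')); auto.
    intros. apply sum_n_m_nonneg; auto.
Qed.

Lemma dsum_switch p r p' r' F :
  dsum p r p' r' F = dsum p' r' p r (fun j i => F i j).
Proof. apply sum_n_m_switch. Qed.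

Lemma dsum_dsum_switch p r p' r' s u s' u' (F : nat -> nat -> nat -> nat -> R) :
  dsum p r p' r' (fun i j => dsum s u s' u' (fun k l => F i j k l)) =
  dsum s u s' u' (fun k l => dsum p r p' r' (fun i j => F i j k l)).
Proof.
  transitivity (sum_n_m (fun i => dsum s u s' u'
    (fun k l => sum_n_m (fun j => F i j k l) p' r')) p r).
  - apply sum_n_m_eq; intros i _. unfold dsum.
    rewrite sum_n_m_switch. apply sum_n_m_eq; intros. apply sum_n_m_switch.
  - unfold dsum. rewrite sum_n_m_switch. apply sum_n_m_eq; intros.
    apply sum_n_m_switch.
Qed.

Lemma dsum_corner m F : (1 <= m)%nat ->
  dsum 1 m 1 m F =
  F 1%nat 1%nat + dsum 2 m 1 1 F + dsum 1 1 2 m F + dsum 2 m 2 m F.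
Proof.
  intros hm. unfold dsum. rewrite sum_n_n, sum_n_m_first by lia.
  rewrite (sum_n_m_first (fun j => F 1%nat j)) by lia.
  rewrite (sum_n_m_eq (fun i => sum_n_m (fun j => F i j) 1 m)
    (fun i => F i 1%nat + sum_n_m (fun j => F i j) 2 m))
    by (intros; apply (sum_n_m_first (fun j => F k j)); lia).
  rewrite sum_n_m_add.
  rewrite (sum_n_m_eq (fun i => sum_n_m (fun j => F i j) 1 1) (fun i => F i 1%nat))
    by (intros; now rewrite sum_n_n).
  lra.
Qed.

(** * Thresholding within one component *)

(** The share of one component in the objective, once everything is written
    in coefficients: up to a constant, a ^ 2 - 2 a z is the squared error
    (a - z) ^ 2. *)
Definition block (lambda : R) (p r p' r' : nat) (q z : nat -> nat -> R)
  (theta : R) (a : nat -> nat -> R) : R :=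
  dsum p r p' r' (fun i j => a i j ^ 2 - 2 * a i j * z i j)
  + / theta * dsum p r p' r' (fun i j => q i j * a i j ^ 2) + lambda * theta.

(** For fixed theta, minimizing each term over its coefficient leaves
    - theta * z ^ 2 / (theta + q).  Since q <= M, this is at least
    - theta * rho * (z ^ 2 / q) with rho = M / (theta + M), so the block is
    at least theta * (lambda - rho * U).  The factor rho < 1, uniform in the
    indices, is what makes the bound strict even when U = lambda. *)
Lemma block_pos lambda p r p' r' q z theta a :
  0 < lambda -> 0 < theta ->
  (forall i j, (p <= i <= r)%nat -> (p' <= j <= r')%nat -> 0 < q i j) ->
  dsum p r p' r' (fun i j => / q i j * z i j ^ 2) <= lambda ->
  0 < block lambda p r p' r' q z theta a.
Proof.
  intros hl ht hq hU. unfold block.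
  set (U := dsum p r p' r' (fun i j => / q i j * z i j ^ 2)) in *.
  set (M := dsum p r p' r' q).
  assert (hM : 0 <= M) by (apply dsum_nonneg; intros; apply Rlt_le; auto).
  set (rho := M / (theta + M)).
  assert (hrho : 0 <= rho < 1).
  { unfold rho; split.
    - apply Rmult_le_pos; [lra | apply Rlt_le, Rinv_0_lt_compat; lra].
    - apply Rmult_lt_reg_r with (theta + M); [lra|].
      unfold Rdiv. rewrite Rmult_assoc, Rinv_l by lra. lra. }
  rewrite <- dsum_scal, <- dsum_add.
  assert (H : - (theta * rho) * U <=
    dsum p r p' r' (fun i j => a i j ^ 2 - 2 * a i j * z i j +
                               / theta * (q i j * a i j ^ 2))).
  { unfold U. rewrite <- dsum_scal. apply dsum_le. intros i j hi hj.
    assert (hqi := hq i j hi hj).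
    assert (hqM : q i j <= M).
    { apply dsum_ge_term; auto. intros; apply Rlt_le; auto. }
    set (Q := q i j) in *. set (A := a i j). set (Z := z i j).
    apply Rle_trans with (- (theta / (theta + Q)) * Z ^ 2).
    - assert (E : theta * rho * / Q - theta / (theta + Q) =
        theta ^ 2 * (M - Q) * / ((theta + M) * Q * (theta + Q))).
      { unfold rho. field. lra. }
      assert (0 <= theta ^ 2 * (M - Q) * / ((theta + M) * Q * (theta + Q))).
      { apply Rmult_le_pos; [apply Rmult_le_pos; [apply pow2_ge_0 | lra]|].
        apply Rlt_le, Rinv_0_lt_compat. repeat apply Rmult_lt_0_compat; lra. }
      assert (hZ := pow2_ge_0 Z). nra.
    - assert (E : A ^ 2 - 2 * A * Z + / theta * (Q * A ^ 2)
        - - (theta / (theta + Q)) * Z ^ 2 =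
        / (theta * (theta + Q)) * ((theta + Q) * A - theta * Z) ^ 2).
      { field. lra. }
      assert (0 <= / (theta * (theta + Q)) * ((theta + Q) * A - theta * Z) ^ 2).
      { apply Rmult_le_pos; [apply Rlt_le, Rinv_0_lt_compat; nra | apply pow2_ge_0]. }
      lra. }
  assert (rho * U < lambda) by nra.
  nra.
Qed.

(** To first order in theta the optimal coefficients are theta * z / q; with
    them the block equals theta * (theta * V - (U - lambda)), where V is the
    sum of (z / q) ^ 2, and this is negative for small theta. *)
Lemma block_neg lambda p r p' r' q z :
  (forall i j, (p <= i <= r)%nat -> (p' <= j <= r')%nat -> 0 < q i j) ->
  lambda < dsum p r p' r' (fun i j => / q i j * z i j ^ 2) ->
  exists theta a, 0 < theta /\ block lambda p r p' r' q z theta a < 0.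
Proof.
  intros hq hU.
  set (U := dsum p r p' r' (fun i j => / q i j * z i j ^ 2)) in *.
  set (V := dsum p r p' r' (fun i j => (/ q i j * z i j) ^ 2)).
  assert (hV : 0 <= V) by (apply dsum_nonneg; intros; apply pow2_ge_0).
  (* Any theta in (0, (U - lambda) / V) works; V + 1 also covers V = 0. *)
  set (theta := (U - lambda) / (V + 1)).
  assert (ht : 0 < theta) by (apply Rdiv_lt_0_compat; lra).
  exists theta, (fun i j => theta * (/ q i j * z i j)). split; [exact ht|].
  unfold block. rewrite <- dsum_scal, <- dsum_add.
  rewrite (dsum_eq _ _ _ _ _ (fun i j => theta ^ 2 * (/ q i j * z i j) ^ 2 +
     (- theta) * (/ q i j * z i j ^ 2))).
  2:{ intros i j hi hj. assert (h := hq i j hi hj). field. lra. }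
  rewrite dsum_add, !dsum_scal. fold U V.
  assert (theta * (V + 1) = U - lambda) by (unfold theta; field; lra).
  nra.
Qed.

(** The convention 0 / 0 = 0 for one component, in terms of coefficients. *)
Definition vanishes (theta : R) (p r p' r' : nat) (a : nat -> nat -> R) : Prop :=
  theta = 0 ->
  forall i j, (p <= i <= r)%nat -> (p' <= j <= r')%nat -> a i j = 0.

(** The pair (0, 0) gives the value 0, so theta > 0 can be optimal only if
    the block takes a value <= 0 there, and theta = 0 only if the block takes
    no negative value. *)
Lemma block_threshold lambda p r p' r' q z theta a :
  0 < lambda -> 0 <= theta ->
  (forall i j, (p <= i <= r)%nat -> (p' <= j <= r')%nat -> 0 < q i j) ->
  vanishes theta p r p' r' a ->
  (forall theta' a', 0 <= theta' ->
     vanishes theta' p r p' r' a' ->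
     block lambda p r p' r' q z theta a <= block lambda p r p' r' q z theta' a') ->
  (dsum p r p' r' (fun i j => / q i j * z i j ^ 2) <= lambda -> theta = 0) /\
  (dsum p r p' r' (fun i j => / q i j * z i j ^ 2) > lambda -> theta > 0).
Proof.
  intros hl ht hq ha hmin.
  assert (H0 : forall a', (forall i j, (p <= i <= r)%nat -> (p' <= j <= r')%nat -> a' i j = 0) ->
    block lambda p r p' r' q z 0 a' = 0).
  { intros a' h. unfold block.
    rewrite !dsum_null; [ring| |]; intros; rewrite h by auto; ring. }
  split; intros hU.
  - destruct (Req_dec theta 0) as [|hne]; [assumption|exfalso].
    assert (0 < block lambda p r p' r' q z theta a)
      by (apply block_pos; auto; lra).
    assert (h := hmin 0 (fun _ _ => 0) (Rle_refl 0) ltac:(easy)).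
    rewrite H0 in h by auto. lra.
  - destruct (Req_dec theta 0) as [h0|hne]; [exfalso|lra].
    destruct (block_neg _ _ _ _ _ _ _ hq hU) as (t & b & htp & hb).
    assert (h := hmin t b ltac:(lra) ltac:(intros e; lra)).
    rewrite h0, H0 in h by auto. lra.
Qed.

(** * The trigonometric basis *)

(** Cosines and sines are treated together as shifted cosines
    A cos (2 pi h t - p) with h = mu / 2; the sine has phase pi / 2.  The
    first and the last function are the only ones with amplitude 1, and their
    frequencies are the extreme values 0 and m / 2. *)
Lemma gamma_wave (m mu : nat) : Nat.Even m ->
  exists A p, (forall t, gamma m mu t = A * cos (2 * PI * INR (Nat.div2 mu) * t - p)) /\
  ((1 <= mu <= m)%nat ->
   ((mu = 1%nat /\ Nat.div2 mu = 0%nat) \/ (mu = m /\ (2 * Nat.div2 mu)%nat = m)) /\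
     A = 1 /\ p = 0 \/
   (0 < 2 * Nat.div2 mu < m)%nat /\ A ^ 2 = 2 /\
   (mu = (2 * Nat.div2 mu)%nat /\ p = 0 \/
    mu = (2 * Nat.div2 mu + 1)%nat /\ p = PI / 2)).
Proof.
  intros [H ->]. unfold gamma.
  assert (s2 : sqrt 2 ^ 2 = 2) by (rewrite <- Rsqr_pow2; apply Rsqr_sqrt; lra).
  destruct (Nat.eqb_spec mu 1) as [->|n1].
  { exists 1, 0. split.
    - intros t. simpl. replace (2 * PI * 0 * t - 0) with 0 by ring. rewrite cos_0. ring.
    - intros _. left. auto. }
  destruct (Nat.eqb_spec mu (2 * H)) as [->|nm].
  { exists 1, 0. rewrite Nat.div2_double. split.
    - intros t. rewrite mult_INR. simpl (INR 2). rewrite Rmult_1_l. f_equal. ring.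
    - intros _. left. auto. }
  assert (D := Nat.div2_odd mu).
  rewrite <- Nat.negb_odd. destruct (Nat.odd mu); simpl Nat.b2n in D; simpl negb; cbv iota.
  - exists (sqrt 2), (PI / 2). split.
    + intros t. rewrite <- cos_shift, <- cos_neg. do 2 f_equal. ring.
    + intros h. right. split; [lia|]. split; [exact s2|]. right. split; [lia|reflexivity].
  - exists (sqrt 2), 0. split.
    + intros t. do 2 f_equal. ring.
    + intros h. right. split; [lia|]. split; [exact s2|]. left. split; [lia|reflexivity].
Qed.

Lemma cos_mul_cos (u v : R) : cos u * cos v = (cos (v - u) + cos (u + v)) / 2.
Proof. rewrite cos_minus, cos_plus. field. Qed.

(** A product of two shifted cosines is a combination of waves with the
    difference and the sum of the two frequencies.  For distinct indices these
    lie strictly between 0 and m, except that a cosine and a sine of equal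
    frequency give the difference 0; that term is constant and equal to
    cos (pi / 2) = 0. *)
Lemma gamma_mul_ne (m mu nu : nat) : Nat.Even m ->
  (1 <= mu <= m)%nat -> (1 <= nu <= m)%nat -> mu <> nu ->
  exists A p i B r j, (0 < i < m)%nat /\ (0 < j < m)%nat /\
  forall t, gamma m mu t * gamma m nu t =
    A * cos (2 * PI * INR i * t - p) + B * cos (2 * PI * INR j * t - r).
Proof.
  intros hm.
  assert (W : forall mu nu, (1 <= mu <= m)%nat -> (1 <= nu <= m)%nat -> mu <> nu ->
    (Nat.div2 mu <= Nat.div2 nu)%nat ->
    exists A p i B r j, (0 < i < m)%nat /\ (0 < j < m)%nat /\
    forall t, gamma m mu t * gamma m nu t =
    A * cos (2 * PI * INR i * t - p) + B * cos (2 * PI * INR j * t - r)).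
  { clear mu nu. intros mu nu h1 h2 hne hle.
    destruct (gamma_wave m mu hm) as (A & p & E & C).
    destruct (gamma_wave m nu hm) as (B & r & F & D).
    specialize (C h1). specialize (D h2).
    assert (P : forall t, gamma m mu t * gamma m nu t =
      A * B / 2 * cos (2 * PI * INR (Nat.div2 nu - Nat.div2 mu) * t - (r - p))
      + A * B / 2 * cos (2 * PI * INR (Nat.div2 nu + Nat.div2 mu) * t - (p + r))).
    { intros t. rewrite E, F, minus_INR, plus_INR by exact hle.
      transitivity (A * B * (cos (2 * PI * INR (Nat.div2 mu) * t - p) *
         cos (2 * PI * INR (Nat.div2 nu) * t - r))); [ring|].
      rewrite cos_mul_cos.
      match goal with |- _ * ((cos ?x + cos ?y) / 2) = _ * cos ?x' + _ * cos ?y' =>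
        replace x' with x by ring; replace y' with y by ring end. field. }
    destruct (Nat.eq_dec (Nat.div2 nu) (Nat.div2 mu)) as [e|ne].
    (* A cosine-sine pair; the vanishing term is replaced by 0 times the
       wave of frequency 1. *)
    - assert (Z : cos (r - p) = 0).
      { destruct C as [(C & _)|(_ & _ & C)]; destruct D as [(D & _)|(_ & _ & D)]; try lia.
        destruct C as [(? & ->)|(? & ->)]; destruct D as [(? & ->)|(? & ->)]; try lia.
        - transitivity (cos (PI / 2)); [f_equal; ring | exact cos_PI2].
        - rewrite <- cos_neg. transitivity (cos (PI / 2)); [f_equal; ring | exact cos_PI2]. }
      exists 0, 0, 1%nat, (A * B / 2), (p + r), (Nat.div2 nu + Nat.div2 mu)%nat.
      split; [lia|]. split.
      + destruct C as [(C & _)|(C & _)]; destruct D as [(D & _)|(D & _)]; lia.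
      + intros t. rewrite P, e, Nat.sub_diag. simpl (INR 0).
        replace (2 * PI * 0 * t - (r - p)) with (- (r - p)) by ring.
        rewrite cos_neg, Z. ring.
    - exists (A * B / 2), (r - p), (Nat.div2 nu - Nat.div2 mu)%nat,
        (A * B / 2), (p + r), (Nat.div2 nu + Nat.div2 mu)%nat.
      split; [|split; [|exact P]].
      all: destruct C as [(C & _)|(C & _)]; destruct D as [(D & _)|(D & _)]; lia. }
  intros h1 h2 hne.
  destruct (le_lt_dec (Nat.div2 mu) (Nat.div2 nu)) as [h|h].
  - now apply W.
  - destruct (W nu mu h2 h1 ltac:(auto) ltac:(lia)) as (A & p & i & B & r & j & hi & hj & E).
    exists A, p, i, B, r, j. split; [exact hi|]. split; [exact hj|].
    intros t. rewrite Rmult_comm. apply E.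
Qed.

(** Normalization, with the exception of mu = m, where the doubled frequency
    is m itself. *)
Lemma gamma_sqr (m mu : nat) : Nat.Even m -> (1 <= mu < m)%nat ->
  exists B p j, (0 < j < m)%nat /\
  forall t, gamma m mu t ^ 2 = 1 + B * cos (2 * PI * INR j * t - p).
Proof.
  intros hm h. destruct (gamma_wave m mu hm) as (A & p & E & C).
  destruct (C ltac:(lia)) as [([(C1 & C2)|(C1 & C2)] & -> & ->)|(C1 & C2 & _)]; [|lia|].
  - exists 0, 0, 1%nat. split; [lia|]. intros t. rewrite E, C2. simpl (INR 0).
    replace (2 * PI * 0 * t - 0) with 0 by ring. rewrite cos_0. ring.
  - exists 1, (2 * p), (2 * Nat.div2 mu)%nat. split; [lia|].
    intros t. rewrite E, Rpow_mult_distr, C2, mult_INR. simpl (INR 2).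
    match goal with |- _ = 1 + 1 * cos ?x =>
      replace x with (2 * (2 * PI * INR (Nat.div2 mu) * t - p)) by ring end.
    rewrite cos_2a_cos. ring.
Qed.

Lemma gamma_top_sqr (m : nat) : Nat.Even m -> (2 <= m)%nat ->
  forall t, gamma m m t ^ 2 = 1 / 2 + 1 / 2 * cos (2 * PI * INR m * t - 0).
Proof.
  intros hm h t. unfold gamma. rewrite Nat.eqb_refl.
  destruct (Nat.eqb_spec m 1); [lia|].
  replace (2 * PI * INR m * t - 0) with (2 * (PI * INR m * t)) by ring.
  rewrite cos_2a_cos. field.
Qed.

(** * Averages that annihilate waves *)

(** Both the average over the design points and the integral over [0, 1]
    are of this kind.  No more is used to show that either of them
    diagonalizes squares, so the residual sum of squares and the penalties
    are handled by the same lemmas. *)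
Definition wave_mean (m : nat) (L : (R -> R) -> R) : Prop :=
  (forall f g, (forall t, f t = g t) -> L f = L g) /\
  (forall f g : R -> R,
     (forall t : R, continuous f t) -> (forall t : R, continuous g t) ->
     L (fun t => f t + g t) = L f + L g) /\
  (forall (c : R) (f : R -> R), (forall t : R, continuous f t) ->
     L (fun t => c * f t) = c * L f) /\
  L (fun _ => 1) = 1 /\
  (forall j p, (0 < j < m)%nat -> L (fun t => cos (2 * PI * INR j * t - p)) = 0).

Lemma continuous_wave (w p t : R) : continuous (fun t => cos (w * t - p)) t.
Proof.
  apply (ex_derive_continuous (fun t => cos (w * t - p))). auto_derive. exact I.
Qed.

Lemma is_RInt_wave (j : nat) (p : R) : (0 < j)%nat ->
  is_RInt (fun t => cos (2 * PI * INR j * t - p)) 0 1 0.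
Proof.
  intros hj. assert (h : 0 < INR j) by (now apply lt_0_INR).
  assert (hpi := PI_RGT_0).
  set (F := fun t => / (2 * PI * INR j) * sin (2 * PI * INR j * t - p)).
  assert (E : minus (F 1) (F 0) = 0).
  { unfold F, minus, plus, opp; simpl.
    replace (2 * PI * INR j * 1 - p) with (- p + 2 * INR j * PI) by ring.
    rewrite sin_period.
    replace (2 * PI * INR j * 0 - p) with (- p) by ring. ring. }
  refine (eq_ind _ (fun v => is_RInt _ 0 1 v) _ _ E).
  apply (is_RInt_derive F).
  - intros t _. unfold F. auto_derive; [exact I|]. unfold Rminus. field. split; lra.
  - intros t _. apply continuous_wave.
Qed.

Lemma wave_mean_RInt (m : nat) : wave_mean m (fun f => RInt f 0 1).
Proof.
  split; [|split; [|split; [|split]]].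
  - intros f g h. apply RInt_ext. intros; apply h.
  - intros f g hf hg. apply (RInt_plus f g);
      apply (ex_RInt_continuous (V := R_CompleteNormedModule)); auto.
  - intros c f hf. apply (RInt_scal f).
    apply (ex_RInt_continuous (V := R_CompleteNormedModule)); auto.
  - rewrite RInt_const. unfold scal; simpl; unfold mult; simpl. ring.
  - intros j p hj. apply is_RInt_unique, is_RInt_wave. lia.
Qed.

Definition design_mean (m : nat) (f : R -> R) : R :=
  / INR m * sum_n_m (fun k => f (INR k / INR m)) 1 m.

(** Telescoping: 2 sin (x / 2) cos (k x - p) is
    sin ((k + 1 / 2) x - p) - sin ((k - 1 / 2) x - p). *)
Lemma sum_wave (x p : R) (n : nat) :
  2 * sin (x / 2) * sum_n_m (fun k => cos (x * INR k - p)) 1 n =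
  sin (x * INR n + x / 2 - p) - sin (x / 2 - p).
Proof.
  induction n as [|n IH].
  - rewrite sum_n_m_zero by lia. simpl (INR 0).
    replace (x * 0 + x / 2 - p) with (x / 2 - p) by ring.
    change (zero : R) with 0. ring.
  - rewrite sum_n_m_last by lia.
    rewrite Rmult_plus_distr_l, IH, S_INR.
    replace (x * INR n + x / 2 - p) with ((x * (INR n + 1) - p) - x / 2) by field.
    replace (x * (INR n + 1) + x / 2 - p) with ((x * (INR n + 1) - p) + x / 2) by field.
    rewrite sin_plus, sin_minus. ring.
Qed.

(** With x = 2 pi j / m the two ends of the telescoping sum differ by j full
    periods, while sin (x / 2) does not vanish for 0 < j < m. *)
Lemma wave_mean_design (m : nat) : (0 < m)%nat -> wave_mean m (design_mean m).
Proof.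
  intros hm. assert (h : 0 < INR m) by (now apply lt_0_INR).
  unfold design_mean. split; [|split; [|split; [|split]]].
  - intros f g E. f_equal. apply sum_n_m_eq. intros; apply E.
  - intros f g _ _. rewrite sum_n_m_add. ring.
  - intros c f _. rewrite sum_n_m_scal. ring.
  - rewrite sum_n_m_const. replace (S m - 1)%nat with m by lia. field. lra.
  - intros j p hj. assert (hj' : 0 < INR j < INR m).
    { split; [apply lt_0_INR | apply lt_INR]; lia. }
    assert (hpi := PI_RGT_0).
    set (x := 2 * PI * (INR j / INR m)).
    assert (hx : 0 < x / 2 < PI).
    { replace (x / 2) with (PI * (INR j / INR m)) by (unfold x; field; lra).
      assert (0 < INR j / INR m) by (apply Rdiv_lt_0_compat; lra).
      assert (INR j / INR m < 1).
      { apply Rmult_lt_reg_r with (INR m); [lra|].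
      unfold Rdiv. rewrite Rmult_assoc, Rinv_l; lra. }
      nra. }
    assert (hs : 0 < sin (x / 2)) by (apply sin_gt_0; lra).
    assert (S := sum_wave x p m).
    replace (x * INR m + x / 2 - p) with (x / 2 - p + 2 * INR j * PI) in S
      by (unfold x; field; lra).
    rewrite sin_period in S.
    rewrite (sum_n_m_eq _ (fun k => cos (x * INR k - p))).
    + assert (Z : sum_n_m (fun k => cos (x * INR k - p)) 1 m = 0).
      { apply (Rmult_eq_reg_l (2 * sin (x / 2))); lra. }
      rewrite Z. ring.
    + intros k _. f_equal. unfold x. field. lra.
Qed.

(** * Diagonalization of squares *)

Lemma continuous_gamma (m mu : nat) : Nat.Even m -> forall t, continuous (gamma m mu) t.
Proof.
  intros hm t. destruct (gamma_wave m mu hm) as (A & p & E & _).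
  apply (continuous_ext (fun t => A * cos (2 * PI * INR (Nat.div2 mu) * t - p))).
  - intros; now rewrite E.
  - apply (continuous_scal_r A (fun t => cos (2 * PI * INR (Nat.div2 mu) * t - p))).
    apply continuous_wave.
Qed.

Lemma continuous_sum (F : nat -> R -> R) (p r : nat) (t : R) :
  (forall k, continuous (F k) t) ->
  continuous (fun t => sum_n_m (fun k => F k t) p r) t.
Proof.
  intros hF. induction r as [|r IH].
  - destruct p as [|p].
    + apply (continuous_ext (F 0%nat)); [|auto]. intros; now rewrite sum_n_n.
    + apply (continuous_ext (fun _ => 0)); [|apply continuous_const].
      intros; now rewrite sum_n_m_zero by lia.
  - destruct (le_lt_dec p (S r)) as [h|h].
    + apply (continuous_ext (fun t => sum_n_m (fun k => F k t) p r + F (S r) t)).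
      * intros; now rewrite sum_n_m_last by lia.
      * apply (continuous_plus (fun t => sum_n_m (fun k => F k t) p r)); auto.
    + apply (continuous_ext (fun _ => 0)); [|apply continuous_const].
      intros; now rewrite sum_n_m_zero by lia.
Qed.

Lemma wave_mean_sum (m : nat) (L : (R -> R) -> R) (F : nat -> R -> R) (p r : nat) :
  wave_mean m L -> (forall k t, continuous (F k) t) ->
  L (fun t => sum_n_m (fun k => F k t) p r) = sum_n_m (fun k => L (F k)) p r.
Proof.
  intros (Lext & Lplus & Lscal & _) hF.
  assert (L0 : forall f, (forall t, f t = 0) -> L f = 0).
  { intros f h. rewrite (Lext f (fun t => 0 * (fun _ => 0) t)).
    - rewrite Lscal by (intros; apply continuous_const). ring.
    - intros. rewrite h. ring. }
  induction r as [|r IH].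
  - destruct p as [|p].
    + rewrite sum_n_n. apply Lext. intros; now rewrite sum_n_n.
    + rewrite sum_n_m_zero by lia. apply L0. intros; now rewrite sum_n_m_zero by lia.
  - destruct (le_lt_dec p (S r)) as [h|h].
    + rewrite sum_n_m_last, <- IH by lia. rewrite <- Lplus; auto.
      * apply Lext. intros; now rewrite sum_n_m_last by lia.
      * intros. now apply continuous_sum.
    + rewrite sum_n_m_zero by lia. apply L0. intros; now rewrite sum_n_m_zero by lia.
Qed.

Lemma wave_mean_gamma_ne (m : nat) (L : (R -> R) -> R) (mu nu : nat) :
  Nat.Even m -> wave_mean m L ->
  (1 <= mu <= m)%nat -> (1 <= nu <= m)%nat -> mu <> nu ->
  L (fun t => gamma m mu t * gamma m nu t) = 0.
Proof.
  intros hm (Lext & Lplus & Lscal & _ & Lwave) h1 h2 hne.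
  destruct (gamma_mul_ne m mu nu hm h1 h2 hne) as (A & p & i & B & r & j & hi & hj & E).
  rewrite (Lext _ _ E).
  assert (C : forall A w p t, continuous (fun t => A * cos (w * t - p)) t).
  { intros. apply (continuous_scal_r A0 (fun t => cos (w * t - p0))). apply continuous_wave. }
  rewrite Lplus by auto.
  rewrite !Lscal, !Lwave by (auto using continuous_wave). ring.
Qed.

Lemma sqr_sum_n_m (u : nat -> R) (p r : nat) :
  sum_n_m u p r ^ 2 = sum_n_m (fun i => sum_n_m (fun j => u i * u j) p r) p r.
Proof.
  rewrite (sum_n_m_eq (fun i => sum_n_m (fun j => u i * u j) p r)
    (fun i => sum_n_m u p r * u i)).
  - rewrite sum_n_m_scal. ring.
  - intros i _. rewrite sum_n_m_scal. ring.
Qed.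

(** Expanding the square gives a double sum of products of basis functions, of
    which only the diagonal has a nonzero mean. *)
Lemma parseval (m : nat) (L : (R -> R) -> R) (b : nat -> R) (p : nat) :
  Nat.Even m -> wave_mean m L -> (1 <= p)%nat ->
  L (fun t => sum_n_m (fun mu => b mu * gamma m mu t) p m ^ 2) =
  sum_n_m (fun mu => L (fun t => gamma m mu t ^ 2) * b mu ^ 2) p m.
Proof.
  intros hm hL hp. assert (hL' := hL). destruct hL' as (Lext & _ & Lscal & _).
  assert (C : forall mu nu t, continuous (fun t => gamma m mu t * gamma m nu t) t).
  { intros. apply (continuous_mult (gamma m mu) (gamma m nu)); now apply continuous_gamma. }
  assert (C' : forall mu nu t,
    continuous (fun t => b mu * b nu * (gamma m mu t * gamma m nu t)) t).
  { intros. apply (continuous_scal_r (b mu * b nu) (fun t => gamma m mu t * gamma m nu t)).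
    apply C. }
  rewrite (Lext _ (fun t => sum_n_m (fun mu => sum_n_m (fun nu =>
    b mu * b nu * (gamma m mu t * gamma m nu t)) p m) p m)).
  2:{ intros t. rewrite sqr_sum_n_m. apply sum_n_m_eq; intros. apply sum_n_m_eq; intros. ring. }
  rewrite (wave_mean_sum m L (fun mu t => sum_n_m (fun nu =>
    b mu * b nu * (gamma m mu t * gamma m nu t)) p m)); auto.
  2:{ intros mu t. apply (continuous_sum (fun nu t =>
        b mu * b nu * (gamma m mu t * gamma m nu t))). auto. }
  apply sum_n_m_eq. intros mu hmu.
  rewrite (wave_mean_sum m L (fun nu t => b mu * b nu * (gamma m mu t * gamma m nu t))); auto.
  rewrite (sum_n_m_single _ _ _ mu); [|lia|].
  - rewrite Lscal by auto.
    rewrite (Lext (fun t => gamma m mu t ^ 2) (fun t => gamma m mu t * gamma m mu t))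
      by (intros; ring). ring.
  - intros nu hnu hne. rewrite Lscal by auto.
    rewrite (wave_mean_gamma_ne m L) by (auto; lia). ring.
Qed.

(** Two applications of the one-variable identity: in t, with the
    coefficients B nu s, and then in s. *)
Lemma parseval2 (m : nat) (L : (R -> R) -> R) (a : nat -> nat -> R) (p p' : nat) :
  Nat.Even m -> wave_mean m L -> (1 <= p)%nat -> (1 <= p')%nat ->
  L (fun s => L (fun t =>
    dsum p m p' m (fun mu nu => a mu nu * gamma m mu s * gamma m nu t) ^ 2)) =
  dsum p m p' m (fun mu nu => L (fun t => gamma m mu t ^ 2) *
    L (fun t => gamma m nu t ^ 2) * a mu nu ^ 2).
Proof.
  intros hm hL hp hp'. assert (hL' := hL). destruct hL' as (Lext & _ & Lscal & _).
  set (N := fun mu => L (fun t => gamma m mu t ^ 2)).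
  set (B := fun nu s => sum_n_m (fun mu => a mu nu * gamma m mu s) p m).
  assert (CB : forall nu s, continuous (fun s => B nu s ^ 2) s).
  { intros. apply (continuous_comp (B nu) (fun x => x ^ 2)).
    - apply (continuous_sum (fun mu s => a mu nu * gamma m mu s)).
      intros mu. apply (continuous_scal_r (a mu nu) (gamma m mu)). now apply continuous_gamma.
    - apply (ex_derive_continuous (fun x => x ^ 2)). auto_derive. exact I. }
  rewrite (Lext _ (fun s => sum_n_m (fun nu => N nu * B nu s ^ 2) p' m)).
  2:{ intros s. unfold N. rewrite <- (parseval m L (fun nu => B nu s)) by auto.
      apply Lext. intros t. f_equal. rewrite dsum_switch. apply sum_n_m_eq. intros nu _.
      unfold B. rewrite Rmult_comm, <- sum_n_m_scal. apply sum_n_m_eq. intros; ring. }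
  rewrite (wave_mean_sum m L (fun nu s => N nu * B nu s ^ 2)); auto.
  2:{ intros nu t. apply (continuous_scal_r (N nu) (fun s => B nu s ^ 2)). auto. }
  rewrite dsum_switch. apply sum_n_m_eq. intros nu _.
  rewrite Lscal by auto. unfold B. rewrite parseval by auto.
  rewrite <- sum_n_m_scal. apply sum_n_m_eq. intros mu _. unfold N. ring.
Qed.

(** For mu = m the wave of frequency m aliases to the constant 1 on the
    design, which makes up for the amplitude 1 in place of sqrt 2. *)
Lemma design_mean_gamma_sqr (m mu : nat) : Nat.Even m -> (1 <= mu <= m)%nat ->
  design_mean m (fun t => gamma m mu t ^ 2) = 1.
Proof.
  intros hm h.
  destruct (wave_mean_design m ltac:(lia)) as (Lext & Lplus & Lscal & L1 & Lwave).
  destruct (Nat.eq_dec mu m) as [->|n].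
  - rewrite <- L1. unfold design_mean. f_equal. apply sum_n_m_eq. intros k _.
    rewrite gamma_top_sqr by (auto; destruct hm; lia).
    assert (0 < INR m) by (apply lt_0_INR; lia).
    replace (2 * PI * INR m * (INR k / INR m) - 0) with (0 + 2 * INR k * PI)
      by (field; lra).
    rewrite cos_period, cos_0. field.
  - destruct (gamma_sqr m mu hm ltac:(lia)) as (B & p & j & hj & E).
    rewrite (Lext _ _ E), Lplus.
    + rewrite Lscal, L1, Lwave by (auto using continuous_wave). ring.
    + intros; apply continuous_const.
    + intros. apply (continuous_scal_r B (fun t => cos (2 * PI * INR j * t - p))).
      apply continuous_wave.
Qed.

(** The integral kills waves of every positive frequency, including m; hence
    the use of wave_mean at S m. *)
Lemma RInt_gamma_sqr_pos (m mu : nat) : Nat.Even m -> (1 <= mu <= m)%nat ->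
  0 < RInt (fun t => gamma m mu t ^ 2) 0 1.
Proof.
  intros hm h.
  assert (hL := wave_mean_RInt (S m)). set (L := fun f : R -> R => RInt f 0 1 : R) in hL.
  change (0 < L (fun t => gamma m mu t ^ 2)). clearbody L.
  destruct hL as (Lext & Lplus & Lscal & L1 & Lwave).
  assert (G : exists D B p j, 0 < D /\ (0 < j < S m)%nat /\ forall t, gamma m mu t ^ 2
    = D + B * cos (2 * PI * INR j * t - p)).
  { destruct (Nat.eq_dec mu m) as [->|n].
    - exists (1 / 2), (1 / 2), 0, m. split; [lra|]. split; [lia|]. intros t.
      rewrite gamma_top_sqr by (auto; destruct hm; lia). ring.
    - destruct (gamma_sqr m mu hm ltac:(lia)) as (B & p & j & hj & E).
      exists 1, B, p, j. split; [lra|]. split; [lia|]. intros t. rewrite E. ring. }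
  destruct G as (D & B & p & j & hD & hj & E).
  rewrite (Lext _ _ E), (Lplus (fun _ => D)).
  - rewrite (Lext (fun _ => D) (fun _ => D * 1)) by (intros; ring).
    rewrite (Lscal D (fun _ => 1)) by (intros; apply continuous_const).
    rewrite Lscal, L1, Lwave by (auto using continuous_wave). lra.
  - intros; apply continuous_const.
  - intros. apply (continuous_scal_r B (fun t => cos (2 * PI * INR j * t - p))).
    apply continuous_wave.
Qed.

(** * The penalties in coefficients *)

Definition wave_number (mu : nat) : R := 2 * PI * INR (Nat.div2 mu).

(** Differentiating twice multiplies each basis function by the same constant
    for cosines and sines; the penalties thus inherit the orthogonality of the
    basis. *)
Lemma is_derive_gamma (m mu : nat) (t : R) : Nat.Even m ->
  is_derive (gamma m mu) t (Derive (gamma m mu) t) /\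
  is_derive (Derive (gamma m mu)) t (- wave_number mu ^ 2 * gamma m mu t).
Proof.
  intros hm. destruct (gamma_wave m mu hm) as (A & p & E & _). fold (wave_number mu) in E.
  set (w := wave_number mu) in *.
  assert (D : forall t, is_derive (gamma m mu) t (- (A * w) * sin (w * t - p))).
  { intros x. apply (is_derive_ext (fun t => A * cos (w * t - p))).
    - intros; now rewrite E.
    - auto_derive; [exact I|]. unfold Rminus. ring. }
  assert (D' : forall t, Derive (gamma m mu) t = - (A * w) * sin (w * t - p)).
  { intros. now apply is_derive_unique. }
  split.
  - rewrite D'. apply D.
  - apply (is_derive_ext (fun t => - (A * w) * sin (w * t - p))).
    + intros; now rewrite D'.
    + rewrite E. auto_derive; [exact I|]. unfold Rminus. ring.
Qed.

Lemma is_derive_sum (F F' : nat -> R -> R) (p r : nat) (t : R) :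
  (forall k, is_derive (F k) t (F' k t)) ->
  is_derive (fun t => sum_n_m (fun k => F k t) p r) t (sum_n_m (fun k => F' k t) p r).
Proof.
  intros hF. induction r as [|r IH].
  - destruct p as [|p].
    + rewrite sum_n_n. apply (is_derive_ext (F 0%nat)); [|auto].
      intros; now rewrite sum_n_n.
    + rewrite sum_n_m_zero by lia. apply (is_derive_ext (fun _ => 0));
        [|apply (is_derive_const 0)].
      intros; now rewrite sum_n_m_zero by lia.
  - destruct (le_lt_dec p (S r)) as [h|h].
    + rewrite sum_n_m_last by lia.
      apply (is_derive_ext (fun t => sum_n_m (fun k => F k t) p r + F (S r) t)).
      * intros; now rewrite sum_n_m_last by lia.
      * apply (is_derive_plus (fun t => sum_n_m (fun k => F k t) p r)); auto.
    + rewrite sum_n_m_zero by lia. apply (is_derive_ext (fun _ => 0));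
        [|apply (is_derive_const 0)].
      intros; now rewrite sum_n_m_zero by lia.
Qed.

Lemma Derive_2_sum_gamma (m : nat) (b : nat -> R) (p : nat) (f : R -> R) (t : R) :
  Nat.Even m -> (forall t, f t = sum_n_m (fun mu => b mu * gamma m mu t) p m) ->
  Derive_n f 2 t = sum_n_m (fun mu => - wave_number mu ^ 2 * b mu * gamma m mu t) p m.
Proof.
  intros hm hf. simpl.
  assert (S : forall k (g g' : R -> R) t, is_derive g t (g' t) ->
     is_derive (fun t => b k * g t) t (b k * g' t)).
  { intros. now apply (is_derive_scal g). }
  rewrite (Derive_ext _ (fun t => sum_n_m (fun mu => b mu * Derive (gamma m mu) t) p m)).
  - apply is_derive_unique.
    rewrite (sum_n_m_eq _ (fun mu => b mu * (- wave_number mu ^ 2 * gamma m mu t)))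
      by (intros; ring).
    apply (is_derive_sum (fun mu t => b mu * Derive (gamma m mu) t)
       (fun mu t => b mu * (- wave_number mu ^ 2 * gamma m mu t))).
    intros k. apply (S k (Derive (gamma m k)) (fun t => - wave_number k ^ 2 * gamma m k t)).
    now apply is_derive_gamma.
  - intros x. apply is_derive_unique.
    apply (is_derive_ext (fun t => sum_n_m (fun mu => b mu * gamma m mu t) p m)).
    + intros; now rewrite hf.
    + apply (is_derive_sum (fun mu t => b mu * gamma m mu t)
        (fun mu t => b mu * Derive (gamma m mu) t)).
      intros k. apply S. now apply is_derive_gamma.
Qed.

Lemma kappa_eq (m mu : nat) : Nat.Even m ->
  kappa m mu = wave_number mu ^ 4 * RInt (fun t => gamma m mu t ^ 2) 0 1.
Proof.
  intros hm. destruct (wave_mean_RInt m) as (Lext & _ & Lscal & _).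
  rewrite <- Lscal.
  - apply Lext. intros t.
    assert (E : Derive_n (gamma m mu) 2 t = - wave_number mu ^ 2 * gamma m mu t)
      by exact (is_derive_unique _ _ _ (proj2 (is_derive_gamma m mu t hm))).
    rewrite E. ring.
  - intros t. apply (continuous_comp (gamma m mu) (fun x => x ^ 2)).
    + now apply continuous_gamma.
    + apply (ex_derive_continuous (fun x => x ^ 2)). auto_derive. exact I.
Qed.

Lemma kappa_pos (m mu : nat) : Nat.Even m -> (2 <= mu <= m)%nat -> 0 < kappa m mu.
Proof.
  intros hm h. rewrite kappa_eq by exact hm. apply Rmult_lt_0_compat.
  - apply pow_lt. unfold wave_number. assert (hpi := PI_RGT_0).
    assert (0 < INR (Nat.div2 mu)); [|apply Rmult_lt_0_compat; lra].
    apply lt_0_INR. assert (D := Nat.div2_odd mu). destruct (Nat.odd mu); simpl in D; lia.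
  - apply RInt_gamma_sqr_pos; [exact hm | lia].
Qed.

Lemma penalty1_sum (m : nat) (b : nat -> R) (f : R -> R) :
  Nat.Even m -> (forall t, f t = sum_n_m (fun mu => b mu * gamma m mu t) 2 m) ->
  penalty1 f = sum_n_m (fun mu => kappa m mu * b mu ^ 2) 2 m.
Proof.
  intros hm hf. unfold penalty1.
  rewrite (RInt_ext _ (fun t => sum_n_m (fun mu =>
     - wave_number mu ^ 2 * b mu * gamma m mu t) 2 m ^ 2)).
  - rewrite (parseval m (fun f => RInt f 0 1) (fun mu => - wave_number mu ^ 2 * b mu));
      [|exact hm | apply wave_mean_RInt | lia].
    apply sum_n_m_eq. intros mu _. rewrite kappa_eq by exact hm. ring.
  - intros t _. now rewrite (Derive_2_sum_gamma m b 2) by auto.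
Qed.

Lemma penalty2_sum (m : nat) (a : nat -> nat -> R) (f : R -> R -> R) :
  Nat.Even m ->
  (forall s t, f s t = dsum 2 m 2 m (fun mu nu => a mu nu * gamma m mu s * gamma m nu t)) ->
  penalty2 f = dsum 2 m 2 m (fun mu nu => kappa m mu * kappa m nu * a mu nu ^ 2).
Proof.
  intros hm hf. unfold penalty2.
  set (a' := fun mu nu => wave_number mu ^ 2 * wave_number nu ^ 2 * a mu nu).
  assert (D : forall s t, Derive_n (fun s' => Derive_n (fun t' => f s' t') 2 t) 2 s =
    dsum 2 m 2 m (fun mu nu => a' mu nu * gamma m mu s * gamma m nu t)).
  { intros s t.
    rewrite (Derive_2_sum_gamma m (fun mu => sum_n_m (fun nu =>
       - wave_number nu ^ 2 * a mu nu * gamma m nu t) 2 m) 2); [|exact hm|].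
    - apply sum_n_m_eq. intros mu _.
      rewrite (Rmult_comm _ (gamma m mu s)), <- Rmult_assoc, <- sum_n_m_scal.
      apply sum_n_m_eq. intros nu _. unfold a'. ring.
    - intros s'.
      rewrite (Derive_2_sum_gamma m (fun nu => sum_n_m (fun mu =>
        a mu nu * gamma m mu s') 2 m) 2); [|exact hm|].
      + rewrite (sum_n_m_eq (fun mu => _ * gamma m mu s')
          (fun mu => sum_n_m (fun nu =>
            - wave_number nu ^ 2 * a mu nu * gamma m nu t * gamma m mu s') 2 m)).
        2:{ intros mu _. rewrite Rmult_comm, <- sum_n_m_scal.
            apply sum_n_m_eq. intros; ring. }
        rewrite sum_n_m_switch. apply sum_n_m_eq. intros nu _.
        rewrite (Rmult_comm _ (gamma m nu t)), <- Rmult_assoc, <- sum_n_m_scal.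
        apply sum_n_m_eq. intros; ring.
      + intros t'. rewrite hf, dsum_switch. apply sum_n_m_eq. intros nu _.
        rewrite Rmult_comm, <- sum_n_m_scal. apply sum_n_m_eq. intros; ring. }
  rewrite (RInt_ext _ (fun s => RInt (fun t =>
    dsum 2 m 2 m (fun mu nu => a' mu nu * gamma m mu s * gamma m nu t) ^ 2) 0 1)).
  2:{ intros s _. apply RInt_ext. intros t _. now rewrite D. }
  rewrite (parseval2 m (fun f => RInt f 0 1) a');
    [|exact hm | apply wave_mean_RInt | lia | lia].
  apply dsum_eq. intros mu nu _ _. rewrite !kappa_eq by exact hm. unfold a'. ring.
Qed.

(** * The objective in coefficients *)

Lemma design_mean_design_mean (m : nat) (f : R -> R -> R) : (0 < m)%nat ->
  design_mean m (fun s => design_mean m (f s)) =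
  / INR (m ^ 2) * dsum 1 m 1 m (fun k l => f (INR k / INR m) (INR l / INR m)).
Proof.
  intros hm. unfold design_mean, dsum. rewrite sum_n_m_scal, pow_INR.
  field. apply not_0_INR. lia.
Qed.

Lemma design_mean_0 (m : nat) (f : R -> R) : (forall t, f t = 0) -> design_mean m f = 0.
Proof.
  intros h. unfold design_mean. rewrite sum_n_m_null; [ring | intros; apply h].
Qed.

(** The mean of the square over the design is the sum of the squared
    coefficients. *)
Lemma gamma_free (m : nat) (b : nat -> R) (p mu : nat) :
  Nat.Even m -> (1 <= p)%nat -> (p <= mu <= m)%nat ->
  (forall t, sum_n_m (fun mu => b mu * gamma m mu t) p m = 0) -> b mu = 0.
Proof.
  intros hm hp hmu h.
  assert (P := parseval m (design_mean m) b p hm (wave_mean_design m ltac:(lia)) hp).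
  rewrite design_mean_0 in P by (intros; rewrite h; ring).
  assert (T := sum_n_m_ge_term (fun mu => b mu ^ 2) p m mu hmu
    ltac:(intros; apply pow2_ge_0)). simpl in T.
  rewrite (sum_n_m_eq _ (fun mu => b mu ^ 2)) in P
    by (intros; rewrite design_mean_gamma_sqr by (auto; lia); ring).
  simpl in P. nra.
Qed.

Lemma gamma_gamma_free (m : nat) (a : nat -> nat -> R) (p p' mu nu : nat) :
  Nat.Even m -> (1 <= p)%nat -> (1 <= p')%nat ->
  (p <= mu <= m)%nat -> (p' <= nu <= m)%nat ->
  (forall s t, dsum p m p' m (fun mu nu => a mu nu * gamma m mu s * gamma m nu t) = 0) ->
  a mu nu = 0.
Proof.
  intros hm hp hp' hmu hnu h.
  apply (gamma_free m (fun nu => a mu nu) p' nu hm hp' hnu). intros t.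
  apply (gamma_free m (fun mu => sum_n_m (fun nu => a mu nu * gamma m nu t) p' m)
    p mu hm hp hmu). intros s.
  rewrite <- (h s t). apply sum_n_m_eq. intros i _.
  rewrite Rmult_comm, <- sum_n_m_scal. apply sum_n_m_eq. intros; ring.
Qed.

Definition coefficients (m : nat) (c : cosso_arg) (a : nat -> nat -> R) : Prop :=
  (forall s t, fit c s t =
     dsum 1 m 1 m (fun mu nu => a mu nu * gamma m mu s * gamma m nu t)) /\
  comp0 c = a 1%nat 1%nat /\
  (forall s, comp1 c s = sum_n_m (fun mu => a mu 1%nat * gamma m mu s) 2 m) /\
  (forall t, comp2 c t = sum_n_m (fun nu => a 1%nat nu * gamma m nu t) 2 m) /\
  (forall s t, comp12 c s t =
     dsum 2 m 2 m (fun mu nu => a mu nu * gamma m mu s * gamma m nu t)).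

(** Discrete orthonormality turns the mean of f ^ 2 into the sum of the
    a ^ 2, and the cross term pairs the coefficients with z. *)
Lemma least_squares_coefficients (m : nat) (y a : nat -> nat -> R) (f : R -> R -> R) :
  Nat.Even m -> (0 < m)%nat ->
  (forall s t, f s t =
     dsum 1 m 1 m (fun mu nu => a mu nu * gamma m mu s * gamma m nu t)) ->
  / INR (m ^ 2) * dsum 1 m 1 m (fun k l =>
      (y k l - f (INR k / INR m) (INR l / INR m)) ^ 2) =
  / INR (m ^ 2) * dsum 1 m 1 m (fun k l => y k l ^ 2) +
  dsum 1 m 1 m (fun mu nu => a mu nu ^ 2 - 2 * a mu nu * z m y mu nu).
Proof.
  intros hm h0 hf.
  rewrite (dsum_eq 1 m 1 m _ (fun k l => y k l ^ 2 +
    (f (INR k / INR m) (INR l / INR m) ^ 2 +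
    (-2) * (y k l * f (INR k / INR m) (INR l / INR m))))) by (intros; ring).
  rewrite (dsum_eq 1 m 1 m (fun mu nu => a mu nu ^ 2 - 2 * a mu nu * z m y mu nu)
    (fun mu nu => a mu nu ^ 2 + (-2) * (a mu nu * z m y mu nu))) by (intros; ring).
  rewrite !dsum_add, !dsum_scal, !Rmult_plus_distr_l.
  assert (S : / INR (m ^ 2) * dsum 1 m 1 m (fun k l =>
    f (INR k / INR m) (INR l / INR m) ^ 2) = dsum 1 m 1 m (fun mu nu => a mu nu ^ 2)).
  { rewrite <- (design_mean_design_mean m (fun s t => f s t ^ 2)) by exact h0.
    destruct (wave_mean_design m h0) as (Lext & _).
    rewrite (Lext _ (fun s => design_mean m (fun t => dsum 1 m 1 m (fun mu nu =>
      a mu nu * gamma m mu s * gamma m nu t) ^ 2))).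
    2:{ intros s. apply Lext. intros t. now rewrite hf. }
    rewrite parseval2; [|exact hm | apply wave_mean_design; exact h0 | lia | lia].
    apply dsum_eq. intros. rewrite !design_mean_gamma_sqr by (auto; lia). ring. }
  assert (C : / INR (m ^ 2) * dsum 1 m 1 m (fun k l =>
    y k l * f (INR k / INR m) (INR l / INR m)) =
    dsum 1 m 1 m (fun mu nu => a mu nu * z m y mu nu)).
  { rewrite (dsum_eq 1 m 1 m _ (fun k l => dsum 1 m 1 m (fun mu nu =>
      a mu nu * (y k l * gamma m mu (INR k / INR m) * gamma m nu (INR l / INR m))))).
    2:{ intros k l _ _. rewrite hf, <- dsum_scal. apply dsum_eq. intros; ring. }
    rewrite dsum_dsum_switch, <- dsum_scal. apply dsum_eq. intros mu nu _ _.
    rewrite dsum_scal. unfold z, dsum. ring. }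
  rewrite S.
  replace (/ INR (m ^ 2) * (-2 * dsum 1 m 1 m (fun k l =>
    y k l * f (INR k / INR m) (INR l / INR m)))) with
   (-2 * (/ INR (m ^ 2) * dsum 1 m 1 m (fun k l =>
    y k l * f (INR k / INR m) (INR l / INR m)))) by ring.
  rewrite C. ring.
Qed.

(** The objective decouples: each theta and the coefficients of its component
    occur in a single block. *)
Lemma cosso_obj_coefficients (m : nat) (y : nat -> nat -> R) (lambda : R)
    (c : cosso_arg) (a : nat -> nat -> R) :
  Nat.Even m -> (2 <= m)%nat -> coefficients m c a ->
  cosso_obj m y lambda c =
  / INR (m ^ 2) * dsum 1 m 1 m (fun k l => y k l ^ 2)
  + (a 1%nat 1%nat ^ 2 - 2 * a 1%nat 1%nat * z m y 1 1)
  + block lambda 2 m 1 1 (q m) (z m y) (th1 c) a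
  + block lambda 1 1 2 m (q m) (z m y) (th2 c) a
  + block lambda 2 m 2 m (q m) (z m y) (th12 c) a.
Proof.
  intros hm h2 (hf & _ & h1' & h2' & h12). unfold cosso_obj.
  assert (L := least_squares_coefficients m y a (fit c) hm ltac:(lia) hf).
  unfold dsum at 1 in L. rewrite L.
  rewrite (dsum_corner m (fun mu nu => a mu nu ^ 2 - 2 * a mu nu * z m y mu nu)) by lia.
  rewrite (penalty1_sum m (fun mu => a mu 1%nat) _ hm h1').
  rewrite (penalty1_sum m (fun nu => a 1%nat nu) _ hm h2').
  rewrite (penalty2_sum m a _ hm h12).
  unfold block.
  rewrite (dsum_eq 2 m 2 m (fun mu nu => q m mu nu * a mu nu ^ 2)
    (fun mu nu => kappa m mu * kappa m nu * a mu nu ^ 2)).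
  2:{ intros mu nu hmu hnu. unfold q.
      destruct (Nat.eqb_spec nu 1); [lia|]. destruct (Nat.eqb_spec mu 1); [lia|]. reflexivity. }
  assert (E1 : dsum 2 m 1 1 (fun mu nu => q m mu nu * a mu nu ^ 2) =
    sum_n_m (fun mu => kappa m mu * a mu 1%nat ^ 2) 2 m).
  { apply sum_n_m_eq. intros. now rewrite sum_n_n. }
  assert (E2 : dsum 1 1 2 m (fun mu nu => q m mu nu * a mu nu ^ 2) =
    sum_n_m (fun nu => kappa m nu * a 1%nat nu ^ 2) 2 m).
  { unfold dsum. rewrite sum_n_n. apply sum_n_m_eq. intros nu hnu. unfold q.
    destruct (Nat.eqb_spec nu 1); [lia|]. reflexivity. }
  rewrite E1, E2. cbv beta. ring.
Qed.

Lemma q_pos (m mu nu : nat) : Nat.Even m -> (1 <= mu <= m)%nat -> (1 <= nu <= m)%nat ->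
  (2 <= mu \/ 2 <= nu)%nat -> 0 < q m mu nu.
Proof.
  intros hm hmu hnu h. unfold q.
  destruct (Nat.eqb_spec nu 1); [apply kappa_pos; [exact hm | lia]|].
  destruct (Nat.eqb_spec mu 1); [apply kappa_pos; [exact hm | lia]|].
  apply Rmult_lt_0_compat; apply kappa_pos; auto; lia.
Qed.

Definition arg_of (m : nat) (t1 t2 t12 : R) (a : nat -> nat -> R) : cosso_arg :=
  CossoArg t1 t2 t12
    (fun s t => dsum 1 m 1 m (fun mu nu => a mu nu * gamma m mu s * gamma m nu t))
    (a 1%nat 1%nat)
    (fun s => sum_n_m (fun mu => a mu 1%nat * gamma m mu s) 2 m)
    (fun t => sum_n_m (fun nu => a 1%nat nu * gamma m nu t) 2 m)
    (fun s t => dsum 2 m 2 m (fun mu nu => a mu nu * gamma m mu s * gamma m nu t)).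

Lemma feasible_arg_of (m : nat) (t1 t2 t12 : R) (a : nat -> nat -> R) :
  0 <= t1 -> 0 <= t2 -> 0 <= t12 ->
  vanishes t1 2 m 1 1 a -> vanishes t2 1 1 2 m a -> vanishes t12 2 m 2 m a ->
  feasible m (arg_of m t1 t2 t12 a).
Proof.
  intros p1 p2 p12 v1 v2 v12. unfold feasible; simpl.
  split; [exists a; repeat split|]. do 3 (split; [assumption|]).
  split; [|split].
  - intros e s. apply sum_n_m_null. intros. rewrite v1 by (auto; lia). ring.
  - intros e t. apply sum_n_m_null. intros. rewrite v2 by (auto; lia). ring.
  - intros e s t. apply dsum_null. intros. rewrite v12 by auto. ring.
Qed.

(** The constraint is on component functions; linear independence of the basis
    carries it over to coefficients. *)
Lemma feasible_vanishes (m : nat) (c : cosso_arg) (a : nat -> nat -> R) :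
  Nat.Even m -> coefficients m c a -> feasible m c ->
  vanishes (th1 c) 2 m 1 1 a /\ vanishes (th2 c) 1 1 2 m a /\
  vanishes (th12 c) 2 m 2 m a.
Proof.
  intros hm (_ & _ & h1 & h2 & h12) (_ & _ & _ & _ & n1 & n2 & n12).
  split; [|split]; intros e i j hi hj.
  - replace j with 1%nat by lia.
    apply (gamma_free m (fun i => a i 1%nat) 2 i hm); [lia | exact hi |].
    intros s. rewrite <- h1. now apply n1.
  - replace i with 1%nat by lia.
    apply (gamma_free m (fun j => a 1%nat j) 2 j hm); [lia | exact hj |].
    intros t. rewrite <- h2. now apply n2.
  - apply (gamma_gamma_free m a 2 2 i j hm); try lia.
    intros s t. rewrite <- h12. now apply n12.
Qed.

(** * Decoupled minimization *)

Definition assemble (a0 a1 a2 a12 : nat -> nat -> R) (i j : nat) : R :=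
  if Nat.eqb j 1 then (if Nat.eqb i 1 then a0 i j else a1 i j)
  else if Nat.eqb i 1 then a2 i j else a12 i j.

Lemma block_ext lambda p r p' r' q z theta a a' :
  (forall i j, (p <= i <= r)%nat -> (p' <= j <= r')%nat -> a i j = a' i j) ->
  block lambda p r p' r' q z theta a = block lambda p r p' r' q z theta a'.
Proof.
  intros h. unfold block. do 2 f_equal; [|f_equal];
    apply dsum_eq; intros; now rewrite h.
Qed.

(** The three blocks can be replaced independently: any admissible choices are
    the blocks of one feasible argument with the same constant term. *)
Lemma minimizer_blocks (m : nat) (y : nat -> nat -> R) (lambda : R)
    (c : cosso_arg) (a : nat -> nat -> R) :
  Nat.Even m -> (2 <= m)%nat -> is_cosso_minimizer m y lambda c -> coefficients m c a ->
  forall t1 t2 t12 a1 a2 a12, 0 <= t1 -> 0 <= t2 -> 0 <= t12 ->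
  vanishes t1 2 m 1 1 a1 -> vanishes t2 1 1 2 m a2 -> vanishes t12 2 m 2 m a12 ->
  block lambda 2 m 1 1 (q m) (z m y) (th1 c) a +
  block lambda 1 1 2 m (q m) (z m y) (th2 c) a +
  block lambda 2 m 2 m (q m) (z m y) (th12 c) a <=
  block lambda 2 m 1 1 (q m) (z m y) t1 a1 +
  block lambda 1 1 2 m (q m) (z m y) t2 a2 +
  block lambda 2 m 2 m (q m) (z m y) t12 a12.
Proof.
  intros hm h2 (_ & hmin) hc t1 t2 t12 a1 a2 a12 p1 p2 p12 v1 v2 v12.
  set (b := assemble a a1 a2 a12).
  assert (b1 : forall i j, (2 <= i <= m)%nat -> (1 <= j <= 1)%nat -> b i j = a1 i j).
  { intros i j hi hj. unfold b, assemble.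
    destruct (Nat.eqb_spec j 1), (Nat.eqb_spec i 1); (reflexivity || lia). }
  assert (b2 : forall i j, (1 <= i <= 1)%nat -> (2 <= j <= m)%nat -> b i j = a2 i j).
  { intros i j hi hj. unfold b, assemble.
    destruct (Nat.eqb_spec j 1), (Nat.eqb_spec i 1); (reflexivity || lia). }
  assert (b12 : forall i j, (2 <= i <= m)%nat -> (2 <= j <= m)%nat -> b i j = a12 i j).
  { intros i j hi hj. unfold b, assemble.
    destruct (Nat.eqb_spec j 1), (Nat.eqb_spec i 1); (reflexivity || lia). }
  assert (hb : feasible m (arg_of m t1 t2 t12 b)).
  { apply feasible_arg_of; try assumption; intros e i j hi hj.
    - rewrite b1; auto.
    - rewrite b2; auto.
    - rewrite b12; auto. }
  specialize (hmin _ hb).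
  rewrite (cosso_obj_coefficients m y lambda c a) in hmin by assumption.
  rewrite (cosso_obj_coefficients m y lambda (arg_of m t1 t2 t12 b) b) in hmin
    by (auto; repeat split).
  cbn [arg_of th1 th2 th12] in hmin.
  rewrite (block_ext lambda 2 m 1 1 _ _ _ b a1 b1),
    (block_ext lambda 1 1 2 m _ _ _ b a2 b2),
    (block_ext lambda 2 m 2 m _ _ _ b a12 b12) in hmin.
  change (b 1%nat 1%nat) with (a 1%nat 1%nat) in hmin. lra.
Qed.

Theorem mainTheorem4 (m : nat) (hm2 : (2 <= m)%nat) (hme : Nat.Even m)
    (y : nat -> nat -> R) (lambda : R) (hlambda : 0 < lambda)
    (c : cosso_arg) (hc : is_cosso_minimizer m y lambda c) :
  ((U1 m y <= lambda -> th1 c = 0 /\ forall s, comp1 c s = 0) /\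
   (U1 m y > lambda -> th1 c > 0)) /\
  ((U2 m y <= lambda -> th2 c = 0 /\ forall t, comp2 c t = 0) /\
   (U2 m y > lambda -> th2 c > 0)) /\
  ((U12 m y <= lambda -> th12 c = 0 /\ forall s t, comp12 c s t = 0) /\
   (U12 m y > lambda -> th12 c > 0)).
Proof.
  assert (hfeas := proj1 hc).
  assert (H := hfeas). destruct H as ((a & ha) & p1 & p2 & p12 & n1 & n2 & n12).
  change (coefficients m c a) in ha.
  destruct (feasible_vanishes m c a hme ha hfeas) as (v1 & v2 & v12).
  assert (hmin := minimizer_blocks m y lambda c a hme hm2 hc ha).
  assert (E1 : U1 m y = dsum 2 m 1 1 (fun i j => / q m i j * z m y i j ^ 2)).
  { apply sum_n_m_eq. intros. now rewrite sum_n_n. }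
  assert (E2 : U2 m y = dsum 1 1 2 m (fun i j => / q m i j * z m y i j ^ 2)).
  { unfold dsum. now rewrite sum_n_n. }
  assert (E12 : U12 m y = dsum 2 m 2 m (fun i j => / q m i j * z m y i j ^ 2))
    by reflexivity.
  rewrite E1, E2, E12.
  destruct (block_threshold lambda 2 m 1 1 (q m) (z m y) (th1 c) a) as (z1 & g1); auto.
  { intros; apply q_pos; auto; lia. }
  { intros t b pt vt.
    assert (h := hmin t (th2 c) (th12 c) b a a pt p2 p12 vt v2 v12). lra. }
  destruct (block_threshold lambda 1 1 2 m (q m) (z m y) (th2 c) a) as (z2 & g2); auto.
  { intros; apply q_pos; auto; lia. }
  { intros t b pt vt.
    assert (h := hmin (th1 c) t (th12 c) a b a p1 pt p12 v1 vt v12). lra. }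
  destruct (block_threshold lambda 2 m 2 m (q m) (z m y) (th12 c) a) as (z12 & g12); auto.
  { intros; apply q_pos; auto; lia. }
  { intros t b pt vt.
    assert (h := hmin (th1 c) (th2 c) t a a b p1 p2 pt v1 v2 vt). lra. }
  auto 10.
Qed.
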